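(* Let $q,z_1,z_2$ be complex numbers, with $q\neq 0$ and $q^2\neq1$. Then for every positive integer $l$, $$q^{lz_2}\sum_{j=0}^{l}q^{-j(z_1+z_2)}q^{2jl}q^{-2j}\left[\begin{array}{c}l\\ j\end{array}\right]_q\prod_{i=1}^{j}[z_2-l+i]_q\prod_{i=1}^{l-j}[z_1-l+i]_q=q^{l(l-1)}\prod_{i=0}^{l-1}[z_1+z_2-2l+i+2]_q .$$
   Context: A logarithm $\log q$ is fixed and $q^z=\exp(z\log q)$ for $z\in\mathbb{C}$; $[z]_q=\frac{q^z-q^{-z}}{q-q^{-1}}$; $[r]_q!=\prod_{s=1}^r[s]_q$, $[0]_q!=1$; $\left[\begin{array}{c}r\\ s\end{array}\right]_q=\frac{[r]_q!}{[s]_q![r-s]_q!}$ for $r\ge s\geq 0$, understood as a Laurent polynomial in $q$ (so it is defined also when some $[k]_q=0$). Empty products equal $1$. *)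

(* Defs.v *)
From mathcomp Require Import all_boot all_order all_algebra.
From mathcomp Require Import reals sequences trigo.
From mathcomp Require Import complex.

Set Implicit Arguments.
Unset Strict Implicit.
Unset Printing Implicit Defensive.

Import Order.TTheory GRing.Theory Num.Theory.
Local Open Scope ring_scope.
Local Open Scope complex_scope.

Definition cexp (R : realType) (z : R[i]) : R[i] :=
  let: a +i* b := z in (expR a * cos b) +i* (expR a * sin b).

Definition qpow (R : realType) (logq z : R[i]) : R[i] := cexp (z * logq).

(* Meant for [cexp logq = q]; the choice of logarithm matters as soon as
   [z] is not an integer. *)
Definition qnum (R : realType) (q logq z : R[i]) : R[i] :=
  (qpow logq z - qpow logq (- z)) / (q - q^-1).

(* For a natural number [k], the Laurent polynomial [k]_x is
   x^(1-k) (1 + x^2 + ... + x^(2(k-1))); [qnum_poly F k] is its second factor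
   and [qfact_poly F r] is x^(r(r-1)/2) [r]_x!. *)
Definition qnum_poly (F : fieldType) (k : nat) : {poly F} :=
  \sum_(0 <= i < k) 'X^(2 * i).

Definition qfact_poly (F : fieldType) (r : nat) : {poly F} :=
  \prod_(1 <= k < r.+1) qnum_poly F k.

Lemma qnum_polyD (F : fieldType) (m n : nat) :
  qnum_poly F (m + n) = qnum_poly F m + 'X^(2 * m) * qnum_poly F n.
Proof.
elim: n => [|n IH].
  by rewrite addn0 /qnum_poly (big_geq (leqnn 0)) mulr0 addr0.
rewrite addnS /qnum_poly !(big_nat_recr _ _ _ (leq0n _)) /=.
by rewrite -!/(qnum_poly F _) IH mulrDr -exprD -mulnDr addrA.
Qed.

Lemma qfact_polyS (F : fieldType) (r : nat) :
  qfact_poly F r.+1 = qfact_poly F r * qnum_poly F r.+1.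
Proof. by rewrite /qfact_poly big_nat_recr. Qed.

Lemma dvdp_qfact_poly (F : fieldType) (m n : nat) :
  qfact_poly F m * qfact_poly F n %| qfact_poly F (m + n).
Proof.
have [r] := ubnP (m + n); elim: r m n => // r IH [|m] [|n] lt_mn_r.
- by rewrite /qfact_poly !big_geq ?mulr1.
- by rewrite /qfact_poly [X in X * _]big_geq // mul1r.
- by rewrite /qfact_poly [X in _ * X]big_geq // mulr1 addn0.
rewrite addSn [qfact_poly F (_ + _).+1]qfact_polyS -addSn qnum_polyD mulrDr.
apply: dvdp_add.
- rewrite qfact_polyS mulrAC dvdp_mul //; apply: IH.
  by move: lt_mn_r; rewrite addSn ltnS.
rewrite mulrCA dvdp_mull // (qfact_polyS F n) mulrA dvdp_mul //.
by rewrite -addSnnS; apply: IH; move: lt_mn_r; rewrite !addSn !addnS.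
Qed.

(* The Laurent polynomial [r]_x! / ([s]_x! [r-s]_x!) evaluated at x = q, for
   s <= r; the division is exact by [dvdp_qfact_poly], and the powers of x
   left aside in [qfact_poly] combine to x^(-s(r-s)). *)
Definition qbinom (F : fieldType) (q : F) (r s : nat) : F :=
  q ^- (s * (r - s)) *
  (qfact_poly F r %/ (qfact_poly F s * qfact_poly F (r - s))).[q].

(* Main.v *)
Require Import Defs.
From mathcomp Require Import all_boot all_order all_algebra.
From mathcomp Require Import reals complex.
From mathcomp Require Import exp trigo ring.

Import Order.TTheory GRing.Theory Num.Theory.
Local Open Scope ring_scope.

(** The identity is a q-Vandermonde (q-Chu-Vandermonde) summation in disguise.
    Put a = q^(z1 - l + 1) and b = q^(z2 - l + 1), and write [u] for
    (u - u^-1) / (q - q^-1).  Collecting all powers of q, the prefactor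
    q^(l z2) times the four powers in the j-th summand equals
    q^(l(l-1)) a^(-j) b^(l-j), and the claim becomes

      sum_j binom(l, j) a^(-j) b^(l-j) prod_(i<j) [b q^i] prod_(i<l-j) [a q^i]
        = prod_(i<l) [a b q^i],

    an identity in an arbitrary field ([q_vandermonde]).  It is proved by
    induction on l.  To pass from l to l + 1 one multiplies by [a b q^l]; in
    the j-th summand this factor is split along the product of u = a q^(l-j)
    and v = b q^j by [uv] = u^-1 [v] + v [u] ([qbracketM]).  The first part
    lengthens the product in b, the second the product in a, and the two
    contributions to each new summand recombine by the Pascal rule for
    Gaussian binomials in their symmetric normalization ([qbinom_pascal]). *)

(** * Gaussian binomials *)

Section GaussianBinomial.
Variable F : fieldType.
Implicit Types (q : F) (m n : nat).

Lemma horner_qnum_poly0 n : (qnum_poly F n.+1).[0] = 1.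
Proof.
rewrite /qnum_poly big_nat_recl // hornerD hornerXn expr0 horner_sum big1 ?addr0 //.
by move=> i _; rewrite hornerXn mulnS expr0n.
Qed.

Lemma qfact_poly0 : qfact_poly F 0 = 1.
Proof. by rewrite /qfact_poly big_geq. Qed.

(** All factors have constant coefficient 1, whatever the characteristic. *)
Lemma qfact_poly_neq0 n : qfact_poly F n != 0.
Proof.
elim: n => [|n IH]; first by rewrite qfact_poly0 oner_neq0.
rewrite qfact_polyS mulf_neq0 //; apply/eqP => /(congr1 (horner^~ 0)).
by rewrite horner_qnum_poly0 horner0 => /eqP; rewrite oner_eq0.
Qed.

(** The Gaussian binomial in its non-symmetric normalization: constant
    coefficient 1 and only even powers of the variable. *)
Definition gauss_poly m n : {poly F} :=
  qfact_poly F (m + n) %/ (qfact_poly F m * qfact_poly F n).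

Lemma gauss_polyK m n :
  gauss_poly m n * (qfact_poly F m * qfact_poly F n) = qfact_poly F (m + n).
Proof. by rewrite divpK // dvdp_qfact_poly. Qed.

(** After clearing the denominators, this is the splitting of the last factor
    of the q-factorial of m + n + 2 given by [qnum_polyD]. *)
Lemma gauss_poly_pascal m n :
  gauss_poly m.+1 n.+1 =
    gauss_poly m n.+1 + 'X^(2 * m.+1) * gauss_poly m.+1 n.
Proof.
apply: (@mulIf _ (qfact_poly F m.+1 * qfact_poly F n.+1)).
  by rewrite mulf_neq0 ?qfact_poly_neq0.
rewrite gauss_polyK addSn qfact_polyS -addSn qnum_polyD mulrDr mulrDl.
congr (_ + _).
  by rewrite -(gauss_polyK m n.+1) (qfact_polyS F m); ring.
by rewrite -addSnnS -(gauss_polyK m.+1 n) (qfact_polyS F n); ring.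
Qed.

Lemma qbinom_gauss_poly q m n :
  qbinom q (m + n) m = q ^- (m * n) * (gauss_poly m n).[q].
Proof. by rewrite /qbinom /gauss_poly addKn. Qed.

Lemma qbinom0 q n : qbinom q n 0 = 1.
Proof.
rewrite /qbinom subn0 mul0n expr0 invr1 mul1r qfact_poly0 mul1r.
by rewrite divpp ?qfact_poly_neq0 // hornerC.
Qed.

Lemma qbinomnn q n : qbinom q n n = 1.
Proof.
rewrite /qbinom subnn muln0 expr0 invr1 mul1r qfact_poly0 mulr1.
by rewrite divpp ?qfact_poly_neq0 // hornerC.
Qed.

(** The symmetric normalization x^(-s(r-s)) turns the single weight of
    [gauss_poly_pascal] into one weight on each term. *)
Lemma qbinom_pascal q m n : q != 0 ->
  qbinom q (m + n).+2 m.+1 =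
    q ^+ m.+1 * qbinom q (m + n).+1 m.+1 + q ^- n.+1 * qbinom q (m + n).+1 m.
Proof.
move=> q0.
rewrite -{1}addnS -addSn qbinom_gauss_poly -{1}addSn qbinom_gauss_poly.
rewrite -addnS qbinom_gauss_poly gauss_poly_pascal hornerD hornerM hornerXn.
rewrite mulrDr addrC !mulrA; congr (_ * _ + _ * _).
  by rewrite mulnS mul2n -addnn !exprD invfM; field; rewrite !expf_neq0.
by rewrite mulSn exprD invfM.
Qed.

End GaussianBinomial.

(** * The q-Vandermonde summation over a field *)

Section Vandermonde.
Variables (F : fieldType) (q : F).
Hypothesis q0 : q != 0.

(** The q-number of z as a function of u = q ^ z: this makes sense in any
    field, with no exponential at hand. *)
Definition qbracket (u : F) : F := (u - u^-1) / (q - q^-1).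

Lemma qbracketM u v : u != 0 -> v != 0 ->
  qbracket (u * v) = u^-1 * qbracket v + v * qbracket u.
Proof.
move=> u0 v0; rewrite /qbracket !mulrA -mulrDl; congr (_ / _).
by field; rewrite u0.
Qed.

(** The q-rising factorial [u] [u q] ... [u q^(n-1)]. *)
Definition qrising (u : F) n : F := \prod_(0 <= i < n) qbracket (u * q ^+ i).

Lemma qrisingS u n : qrising u n.+1 = qrising u n * qbracket (u * q ^+ n).
Proof. by rewrite /qrising big_nat_recr. Qed.

(** The q-analogue of Vandermonde's convolution for rising factorials; its proof
    follows the classical one, with [qbracketM] in place of
    (x + y + l) = (x + l - j) + (y + j). *)
Lemma q_vandermonde (a b : F) l : a != 0 -> b != 0 ->
  \sum_(0 <= j < l.+1)
     a ^- j * b ^+ (l - j) * qbinom q l j * qrising b j * qrising a (l - j)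
  = qrising (a * b) l.
Proof.
move=> a0 b0; elim: l => [|l IH].
  by rewrite big_nat1 qbinom0 /qrising !big_geq // !expr0 invr1 !mulr1.
rewrite qrisingS -IH big_distrl /=.
pose U j := a ^- j.+1 * b ^+ (l - j) * (q ^- (l - j) * qbinom q l j) *
            qrising b j.+1 * qrising a (l - j).
pose V j := a ^- j * b ^+ (l - j).+1 * (q ^+ j * qbinom q l j) *
            qrising b j * qrising a (l - j).+1.
transitivity (\sum_(0 <= j < l.+1) (U j + V j)); last first.
  apply: eq_big_nat => j /andP[_ lejl]; rewrite ltnS in lejl.
  have -> : a * b * q ^+ l = (a * q ^+ (l - j)) * (b * q ^+ j).
    by rewrite -{1}(subnK lejl) exprD; ring.
  rewrite qbracketM ?mulf_neq0 ?expf_neq0 // /U /V !qrisingS !exprS !invfM.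
  ring.
(* U j belongs to the new summand of index j + 1, and V j to that of index j;
   the extreme summands receive a single contribution. *)
rewrite big_split /= [X in X + _]big_nat_recr //= [X in _ + X]big_nat_recl //=.
rewrite big_nat_recl // big_nat_recr //=.
have -> : a ^- 0 * b ^+ (l.+1 - 0) * qbinom q l.+1 0 * qrising b 0 *
          qrising a (l.+1 - 0) = V 0%N.
  by rewrite /V !qbinom0 !subn0 !expr0 !mulr1.
have -> : a ^- l.+1 * b ^+ (l.+1 - l.+1) * qbinom q l.+1 l.+1 *
          qrising b l.+1 * qrising a (l.+1 - l.+1) = U l.
  by rewrite /U !qbinomnn !subnn expr0 invr1 !mulr1.
have -> : \sum_(0 <= j < l)
            a ^- j.+1 * b ^+ (l.+1 - j.+1) * qbinom q l.+1 j.+1 *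
            qrising b j.+1 * qrising a (l.+1 - j.+1) =
          \sum_(0 <= j < l) (U j + V j.+1).
  apply: eq_big_nat => j /andP[_ ltjl].
  rewrite /U /V; have [n ->] : exists n, l = (j + n).+1.
    by exists (l - j.+1)%N; rewrite -addSn subnKC.
  rewrite qbinom_pascal // !subSS.
  have -> : ((j + n).+1 - j = n.+1)%N by rewrite -addnS addKn.
  by rewrite addKn; ring.
by rewrite big_split /=; ring.
Qed.

End Vandermonde.

(** * Complex powers of q *)

Section ComplexPower.
Variable R : realType.
Implicit Types (logq z w : R[i]).
Local Open Scope complex_scope.

Lemma cexp0 : cexp (0 : R[i]) = 1.
Proof. by rewrite /cexp /= expR0 cos0 sin0 mulr1 mulr0. Qed.

Lemma cexpD z w : cexp (z + w) = cexp z * cexp w.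
Proof.
case: z w => [a b] [c d]; apply/eqP; rewrite eq_complex /=.
by rewrite expRD cosD sinD; apply/andP; split; apply/eqP; ring.
Qed.

Lemma qpowD logq z w : qpow logq (z + w) = qpow logq z * qpow logq w.
Proof. by rewrite /qpow mulrDl cexpD. Qed.

Lemma qpow0 logq : qpow logq 0 = 1.
Proof. by rewrite /qpow mul0r cexp0. Qed.

Lemma qpow_neq0 logq z : qpow logq z != 0.
Proof.
apply/eqP => z0; have := qpowD logq z (- z).
by rewrite subrr qpow0 z0 mul0r => /eqP; rewrite oner_eq0.
Qed.

Lemma qpowN logq z : qpow logq (- z) = (qpow logq z)^-1.
Proof.
apply: (mulfI (qpow_neq0 logq z)).
by rewrite -qpowD subrr qpow0 mulfV ?qpow_neq0.
Qed.

Lemma qpowMn logq n z : qpow logq (n%:R * z) = qpow logq z ^+ n.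
Proof.
elim: n => [|n IH]; first by rewrite mul0r qpow0.
by rewrite -natr1 mulrDl mul1r qpowD IH exprSr.
Qed.

(** Integer shifts of z multiply q ^ z by powers of q because q is the
    exponential of its chosen logarithm; this turns products of q-numbers
    into q-rising factorials. *)
Lemma qnum_shift logq z n :
  qnum (cexp logq) logq (z + n%:R) =
  qbracket _ (cexp logq) (qpow logq z * cexp logq ^+ n).
Proof.
rewrite /qnum /qbracket qpowN qpowD -[n%:R]mulr1 qpowMn.
by rewrite {2 4}/qpow mul1r.
Qed.

End ComplexPower.

Theorem theorem3p1 (R : realType) (q logq z1 z2 : R[i])
    (hq0 : q != 0) (hq2 : q ^+ 2 != 1) (hlog : cexp logq = q)
    (l : nat) (hl : (0 < l)%N) :
  qpow logq (l%:R * z2) *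
  (\sum_(0 <= j < l.+1)
     qpow logq (- (j%:R * (z1 + z2))) * qpow logq (2 * j%:R * l%:R) *
     qpow logq (- (2 * j%:R)) * qbinom q l j *
     (\prod_(1 <= i < j.+1) qnum q logq (z2 - l%:R + i%:R)) *
     (\prod_(1 <= i < (l - j).+1) qnum q logq (z1 - l%:R + i%:R)))
  = qpow logq (l%:R * (l%:R - 1)) *
    \prod_(0 <= i < l) qnum q logq (z1 + z2 - 2 * l%:R + i%:R + 2).
Proof.
pose w1 := z1 - l%:R + 1; pose w2 := z2 - l%:R + 1.
have shifted z n : \prod_(1 <= i < n.+1) qnum q logq (z - l%:R + i%:R) =
    qrising _ q (qpow logq (z - l%:R + 1)) n.
  rewrite big_add1 /=; apply: eq_bigr => i _.
  by rewrite -hlog -qnum_shift -nat1r addrA.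
have -> : \prod_(0 <= i < l) qnum q logq (z1 + z2 - 2 * l%:R + i%:R + 2) =
    qrising _ q (qpow logq w1 * qpow logq w2) l.
  apply: eq_bigr => i _; rewrite -hlog -qpowD -qnum_shift /w1 /w2.
  by congr qnum; ring.
rewrite -q_vandermonde ?qpow_neq0 // !big_distrr /=.
apply: eq_big_nat => j /andP[_ lejl]; rewrite ltnS in lejl.
rewrite !shifted -/w1 -/w2 !mulrA; do 4!congr (_ * _).
(* Only powers of q are left, and their exponents agree. *)
rewrite -!qpowMn -qpowN -!qpowD; congr qpow.
by rewrite natrB // /w1 /w2; ring.
Qed.
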